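(* Let $V$ be a $2N$-dimensional real vector space, and let $\omega : V \times V \to \mathbb{R}$ be a nondegenerate, antisymmetric, bilinear form. A linear map $T : V \to V$ satisfies $T^2 = 1$ and $T^T \omega T = -\omega$ if and only if there is a basis for $V$ in which $T$ and $\omega$ are represented by the matrices $$T \equiv \begin{bmatrix} \mathbb{I}_N & 0 \\ 0 & -\mathbb{I}_N \end{bmatrix} \quad\text{and}\quad \omega \equiv \begin{bmatrix} 0 & -\mathbb{I}_N \\ \mathbb{I}_N & 0 \end{bmatrix}.$$
   Context: $\mathbb{I}_N$ denotes the $N\times N$ identity matrix. The condition $T^T\omega T=-\omega$ means $\omega(Tu,Tv)=-\omega(u,v)$ for all $u,v\in V$. In a basis $(e_i)$ the form $\omega$ is represented by the matrix with entries $\omega(e_i,e_j)$, and $T$ by its usual matrix as a linear map. *)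

(* Defs.v *)
From HB Require Import structures.
From mathcomp Require Import all_boot all_order all_algebra.
From mathcomp Require Import reals.

Set Implicit Arguments.
Unset Strict Implicit.
Unset Printing Implicit Defensive.

Import GRing.Theory.
Local Open Scope ring_scope.

(* Column convention: column j holds the coordinates of f e_j.  (The library's
   mxof acts on row vectors, so it is the transpose of this matrix.) *)
Definition lfun_mx (K : fieldType) (V : vectType K) (n : nat)
    (e : n.-tuple V) (f : 'End(V)) : 'M[K]_n :=
  \matrix_(i < n, j < n) coord e i (f e`_j).

Definition form_mx (K : fieldType) (V : vectType K) (n : nat)
    (e : n.-tuple V) (w : V -> V -> K) : 'M[K]_n :=
  \matrix_(i < n, j < n) w e`_i e`_j.

(* Main.v *)
(* The eigenspaces P = ker (T - 1) and Q = ker (T + 1) span V because u = (u + T u)/2 + (u - T u)/2,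
   and both are isotropic because omega(u, v) = omega(T u, T v) = - omega(u, v) on each of them.
   By nondegeneracy omega then pairs P and Q perfectly, so both have dimension N, and a basis of P
   together with minus its omega-dual basis in Q is the required basis of V. *)
Require Import Defs.
From HB Require Import structures.
From mathcomp Require Import all_boot all_order all_algebra.
From mathcomp Require Import reals.

Set Implicit Arguments.
Unset Strict Implicit.
Unset Printing Implicit Defensive.

Import GRing.Theory.
Local Open Scope ring_scope.

Section MatrixRepresentation.
Variables (K : fieldType) (V : vectType K).

Lemma nth_cat_tuple_lshift m n (X : m.-tuple V) (Y : n.-tuple V) (i : 'I_m) :
  (cat_tuple X Y)`_(lshift n i) = X`_i.
Proof. by rewrite nth_cat size_tuple /= ltn_ord. Qed.

Lemma nth_cat_tuple_rshift m n (X : m.-tuple V) (Y : n.-tuple V) (j : 'I_n) :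
  (cat_tuple X Y)`_(rshift m j) = Y`_j.
Proof. by rewrite nth_cat size_tuple /= ltnNge leq_addr addKn. Qed.

Lemma lfun_mxE n (e : n.-tuple V) (f : 'End(V)) (j : 'I_n) :
  basis_of fullv e -> f e`_j = \sum_i lfun_mx e f i j *: e`_i.
Proof.
move=> be; rewrite {1}(coord_basis be (memvf (f e`_j))).
by apply: eq_bigr => i _; rewrite mxE.
Qed.

Lemma lfun_mx_eigenbasis n (e : n.-tuple V) (f : 'End(V)) (d : 'rV_n) :
    free e -> (forall j : 'I_n, f e`_j = d 0 j *: e`_j) ->
  lfun_mx e f = diag_mx d.
Proof.
move=> fe fE; apply/matrixP => i j; rewrite !mxE fE linearZ /= coord_free //.
by case: eqVneq => [->|_]; rewrite ?mulr1 ?mulr0.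
Qed.

Lemma eigenbasis_lfun_mx n (e : n.-tuple V) (f : 'End(V)) (d : 'rV_n) :
    basis_of fullv e -> lfun_mx e f = diag_mx d ->
  forall j : 'I_n, f e`_j = d 0 j *: e`_j.
Proof.
move=> be fE j; rewrite (lfun_mxE _ _ be) fE (bigD1 j) //= big1 ?addr0.
  by rewrite mxE eqxx.
by move=> i /negbTE ij; rewrite mxE ij scale0r.
Qed.

(** Pairing a linear relation among the vectors of [e] with each [e_j] shows that its row of
    coefficients is killed by the invertible Gram matrix. Freeness of the final basis is thus read
    off from the matrix of the form. *)
Lemma form_mx_free n (e : n.-tuple V) (w : {skew_symmetric V}) :
  form_mx e w \in unitmx -> free e.
Proof.
move=> we; apply/freeP => k k0 i.
suff: \row_j k j = 0 by move/rowP/(_ i); rewrite !mxE.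
apply: (can_inj (mulmxK we)); rewrite mul0mx.
apply/rowP => j; rewrite !mxE.
transitivity (w (\sum_i k i *: e`_i) e`_j); last by rewrite k0 linear0l.
by rewrite linear_sumlz; apply: eq_bigr => l _; rewrite !mxE linearZl_LR.
Qed.

End MatrixRepresentation.

Section IsotropicSplitting.
Variables (K : fieldType) (V : vectType K) (w : {skew_symmetric V}).
Hypothesis w_nondeg : nondegenerate w.

Lemma skewC u v : w u v = - w v u.
Proof. by rewrite hermC expr1 mulN1r. Qed.

Lemma nondegenerate_eq0 v : (forall u, w u v = 0) -> v = 0.
Proof.
move=> v0; apply/eqP; rewrite -memv0 -(eqP w_nondeg).
by apply/mem_orthovP => u _; rewrite skewC v0 oppr0.
Qed.

Definition isotropic (P : {vspace V}) := {in P &, forall u v, w u v = 0}.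

Variables P Q : {vspace V}.
Hypotheses (PQ : (P + Q)%VS = fullv) (isoQ : isotropic Q).

(** When [X] is a basis of [P], this is the map from [V] to the dual of [P] induced by [w], written
    in the coordinates dual to [X]. *)
Definition pairing_row n (X : n.-tuple V) (v : V) : 'rV[K]_n :=
  \row_i w X`_i v.

Fact pairing_row_is_linear n (X : n.-tuple V) : linear (pairing_row X).
Proof. by move=> a u v; apply/rowP => i; rewrite !mxE linearPr. Qed.

HB.instance Definition _ n (X : n.-tuple V) :=
  GRing.isLinear.Build K V 'rV[K]_n _ (pairing_row X) (pairing_row_is_linear X).

Definition pairing n (X : n.-tuple V) : 'Hom(V, 'rV[K]_n) :=
  linfun (pairing_row X).

Lemma pairingE n (X : n.-tuple V) v i : pairing X v 0 i = w X`_i v.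
Proof. by rewrite lfunE mxE. Qed.

(** A vector of [Q] in the kernel is orthogonal to [P] because [X] spans it, and to [Q] by isotropy,
    hence to all of [V]. *)
Lemma pairing_inj n (X : n.-tuple V) :
  basis_of P X -> (Q :&: lker (pairing X) = 0)%VS.
Proof.
move=> bX; apply/eqP; rewrite -subv0; apply/subvP => v /memv_capP[vQ].
rewrite memv_ker memv0 => /eqP v0; apply/eqP/nondegenerate_eq0 => u.
have /memv_addP[p pP [q qQ ->]] : u \in (P + Q)%VS by rewrite PQ memvf.
rewrite linearDl /= (isoQ qQ vQ) addr0 (coord_basis bX pP) linear_sumlz big1 // => i _.
by rewrite linearZl_LR /= -pairingE v0 mxE mulr0.
Qed.

(** The pairing embeds [Q] into the dual of [P]. If [P] is isotropic too, exchanging the two gives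
    equality. *)
Lemma dim_isotropic_le : (\dim Q <= \dim P)%N.
Proof.
rewrite -(limg_dim_eq (pairing_inj (vbasisP P))).
by rewrite (leq_trans (dimvS (subvf _))) // dimvf dim_matrix mul1r.
Qed.

Lemma pairing_surj n (X : n.-tuple V) :
  basis_of P X -> \dim Q = n -> (pairing X @: Q)%VS = fullv.
Proof.
move=> bX dQ; apply/eqP; rewrite eqEdim subvf (limg_dim_eq (pairing_inj bX)).
by rewrite dimvf dim_matrix mul1r dQ leqnn.
Qed.

(** Each [Y_j] is a preimage in [Q] of minus the [j]-th unit row under the pairing; the sign matches
    the upper right block of the target matrix. *)
Lemma dual_family n (X : n.-tuple V) : basis_of P X -> \dim Q = n ->
  exists Y : n.-tuple V, (forall j : 'I_n, Y`_j \in Q) /\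
    (forall i j : 'I_n, w X`_i Y`_j = - (i == j)%:R).
Proof.
move=> bX dQ.
have surj j : exists v, (v \in Q) && (pairing X v == - delta_mx 0 j).
  have: - delta_mx 0 j \in (pairing X @: Q)%VS by rewrite pairing_surj ?memvf.
  by case/memv_imgP => v vQ ->; exists v; rewrite vQ eqxx.
pose Y := [tuple xchoose (surj j) | j < n].
have YE (j : 'I_n) : Y`_j = xchoose (surj j) by rewrite -tnth_nth tnth_mktuple.
exists Y; split=> [j|i j]; rewrite YE; case/andP: (xchooseP (surj j)) => // _ /eqP E.
by rewrite -pairingE E !mxE eqxx.
Qed.

End IsotropicSplitting.

Section AntisymplecticInvolution.
Variables (K : fieldType) (V : vectType K) (w : {skew_symmetric V}) (T : 'End(V)).
Hypotheses (two_neq0 : 2%:R != 0 :> K) (T2 : (T \o T)%VF = \1%VF)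
  (Tw : forall u v, w (T u) (T v) = - w u v).

Lemma eigenspaceP a v :
  reflect (T v = a *: v) (v \in passmx.leigenspace T a).
Proof. by rewrite memv_ker !lfun_simp subr_eq0; apply: eqP. Qed.

Lemma involution_eigenspace_sum :
  (passmx.leigenspace T 1 + passmx.leigenspace T (-1))%VS = fullv.
Proof.
apply/eqP; rewrite eqEsubv subvf; apply/subvP => u _.
have TT v : T (T v) = v by rewrite -comp_lfunE T2 id_lfunE.
have -> : u = 2%:R^-1 *: (u + T u) + 2%:R^-1 *: (u - T u).
  by rewrite -scalerDr addrACA subrr addr0 -mulr2n -scaler_nat scalerA mulVf ?scale1r.
apply: memv_add; apply: memvZ; apply/eigenspaceP.
  by rewrite linearD /= TT scale1r addrC.
by rewrite linearB /= TT scaleN1r opprB.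
Qed.

(** Assuming only that the square of [a] is 1 treats both eigenvalues at once: [w u v] equals its
    own opposite, and 2 is invertible. *)
Lemma eigenspace_isotropic a : a ^+ 2 = 1 -> isotropic w (passmx.leigenspace T a).
Proof.
move=> a2 u v /eigenspaceP Tu /eigenspaceP Tv; have := Tw u v.
rewrite Tu Tv linearZl_LR linearZr_LR /= mulrA -expr2 a2 mul1r => /eqP.
by rewrite -subr_eq0 opprK -mulr2n -mulr_natl mulf_eq0 (negPf two_neq0) => /eqP.
Qed.

End AntisymplecticInvolution.

(** The matrix squares to minus the identity, so its inverse is its opposite. *)
Lemma block_symplectic_unit (K : fieldType) N :
  (block_mx 0 (- 1%:M) 1%:M 0 : 'M[K]_(N + N)) \in unitmx.
Proof.
suff /mulmx1_unit[] : (block_mx 0 (- 1%:M) 1%:M 0 : 'M[K]_(N + N)) *m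
  block_mx 0 1%:M (- 1%:M) 0 = 1%:M by [].
rewrite mulmx_block !mulmx0 !mul0mx !mulNmx !mulmxN !mul1mx opprK !addr0 !add0r.
by rewrite -scalar_mx_block.
Qed.

(** In diagonal form, the matrix of [T] says exactly that each basis vector is an eigenvector, which
    serves both directions. *)
Lemma block_signature_diag (K : fieldType) N :
  (block_mx 1%:M 0 0 (- 1%:M) : 'M[K]_(N + N))
  = diag_mx (row_mx (const_mx 1) (const_mx (-1))).
Proof. by rewrite diag_mx_row !diag_const_mx raddfN. Qed.

Theorem proposition1 (R : realType) (N : nat) (V : vectType R)
    (omega : {skew_symmetric V}) (T : 'End(V))
    (dimV : \dim {:V} = (2 * N)%N)
    (omega_nondeg : nondegenerate omega) :
  ((T \o T)%VF = \1%VF /\ (forall u v : V, omega (T u) (T v) = - omega u v))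
  <->
  (exists e : (N + N).-tuple V,
     [/\ basis_of fullv e,
         lfun_mx e T = block_mx 1%:M 0 0 (- 1%:M) &
         form_mx e omega = block_mx 0 (- 1%:M) 1%:M 0]).
Proof.
split=> [[T2 Tw]|[e [be Te we]]].
  have two_neq0 : 2%:R != 0 :> R by rewrite Num.Theory.pnatr_eq0.
  pose P := passmx.leigenspace T 1; pose Q := passmx.leigenspace T (-1).
  have PQ : (P + Q)%VS = fullv := involution_eigenspace_sum two_neq0 T2.
  have isoP : isotropic omega P.
    by apply: eigenspace_isotropic => //; rewrite expr1n.
  have isoQ : isotropic omega Q.
    by apply: eigenspace_isotropic => //; rewrite sqrrN expr1n.
  have dPQ : \dim P = \dim Q.
    apply/eqP; rewrite eqn_leq (dim_isotropic_le omega_nondeg PQ isoQ) andbT.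
    by apply: (dim_isotropic_le omega_nondeg _ isoP); rewrite addvC.
  (* A common vector is orthogonal to both isotropic summands, hence to [V]. *)
  have PQ0 : (P :&: Q = 0)%VS.
    apply/eqP; rewrite -subv0; apply/subvP => v /memv_capP[vP vQ].
    rewrite memv0; apply/eqP/(nondegenerate_eq0 omega_nondeg) => u.
    have /memv_addP[p pP [q qQ ->]] : u \in (P + Q)%VS by rewrite PQ memvf.
    by rewrite linearDl /= (isoP _ _ pP vP) (isoQ _ _ qQ vQ) addr0.
  have dQ : \dim Q = N.
    apply: double_inj; rewrite -(mul2n N) -dimV -PQ dimv_disjoint_sum //.
    by rewrite dPQ addnn.
  have [X bX] : exists X : N.-tuple V, basis_of P X.
    by rewrite -dQ -dPQ; exists (vbasis P); apply: vbasisP.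
  have [Y [YQ XY]] := dual_family omega_nondeg PQ isoQ bX dQ.
  have XP (i : 'I_N) : X`_i \in P.
    by apply: (basis_mem bX); rewrite mem_nth ?size_tuple.
  (* Isotropy clears the diagonal blocks, duality gives the upper right one, and skew-symmetry the
     lower left one. *)
  have we : form_mx (cat_tuple X Y) omega = block_mx 0 (- 1%:M) 1%:M 0.
    rewrite -[LHS]submxK; congr block_mx; apply/matrixP => i j;
      rewrite !mxE ?nth_cat_tuple_lshift ?nth_cat_tuple_rshift.
    - exact: isoP.
    - exact: XY.
    - by rewrite skewC XY opprK eq_sym.
    - exact: isoQ.
  have fe : free (cat_tuple X Y).
    by apply: (@form_mx_free _ _ _ _ omega); rewrite we block_symplectic_unit.
  exists (cat_tuple X Y); split=> //.
    (* A free family of [2 * N] vectors spans by dimension count. *)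
    by rewrite basisEfree fe subvf dimV size_tuple mul2n addnn leqnn.
  rewrite block_signature_diag; apply: lfun_mx_eigenbasis => // j.
  case: (split_ordP j) => k ->; rewrite ?nth_cat_tuple_lshift ?nth_cat_tuple_rshift.
    by rewrite row_mxEl mxE; apply/eigenspaceP.
  by rewrite row_mxEr mxE; apply/eigenspaceP.
(* Converse: [d] lists the signs by which [T] scales the basis vectors, and both identities are
   checked on the basis. *)
rewrite block_signature_diag in Te; set d := row_mx _ _ in Te.
have TE := eigenbasis_lfun_mx be Te.
have d2 j : d 0 j * d 0 j = 1.
  by rewrite !mxE; case: splitP => k _; rewrite !mxE ?mulr1 // mulN1r opprK.
have eE v := coord_basis be (memvf v).
split.
  apply/lfunP => v; rewrite comp_lfunE id_lfunE [in LHS](eE v) [RHS]eE !linear_sum.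
  by apply: eq_bigr => j _; rewrite !linearZ /= TE linearZ /= TE !scalerA -mulrA d2 mulr1.
(* The left side is [d_i * d_j] times the Gram entry. For indices in the same half that entry is 0;
   for indices in opposite halves the product of signs is -1. *)
have wE (i j : 'I_(N + N)) : omega (T e`_i) (T e`_j) = - omega e`_i e`_j.
  have -> : omega e`_i e`_j = form_mx e omega i j by rewrite mxE.
  rewrite !TE linearZl_LR linearZr_LR /=.
  have -> : omega e`_i e`_j = form_mx e omega i j by rewrite mxE.
  rewrite we /d; case: (split_ordP i) => k ->; case: (split_ordP j) => l ->;
    rewrite ?row_mxEl ?row_mxEr ?block_mxEul ?block_mxEur ?block_mxEdl ?block_mxEdr !mxE;
    by rewrite ?mulr0 ?oppr0 ?mulN1r ?mul1r.
(* Bilinearity extends [wE] to all vectors, expanding first [u] and then [v]. *)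
move=> u v; rewrite [in LHS](eE u) [in RHS](eE u) [T (\sum_i _)]linear_sum /=.
rewrite !linear_sumlz -sumrN; apply: eq_bigr => i _.
rewrite [T (_ *: _)]linearZ !linearZl_LR /= -mulrN; congr (_ * _).
rewrite [in LHS](eE v) [in RHS](eE v) [T (\sum_i _)]linear_sum /=.
rewrite !linear_sumr -sumrN; apply: eq_bigr => j _.
by rewrite [T (_ *: _)]linearZ !linearZr_LR /= wE mulrN.
Qed.
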